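(* Fix a natural number $n\ge 3$ and a tree $Q$ of order at least $2$ with root vertex $v$. Let $P: u_1 u_2\cdots u_n$ be a path of order $n$. For $s\in\{1,\dots,n\}$, let $T_s$ be the tree obtained from the disjoint union of $P$ and $Q$ by gluing $v$ to $u_s$. Among all the trees $T_s$, $1\le s\le n$, the tree $T_{\lfloor (n+1)/2\rfloor}$ is the optimal tree; in other words, the maximum of the mean subtree orders $M_{T_s}$ over $s\in\{1,\dots,n\}$ occurs when $v$ is glued to a central vertex of $P$.
   Context: All graphs are finite and simple; the order of a graph is its number of vertices. A subtree of a tree $T$ is a nonempty connected subgraph of $T$. The mean subtree order $M_T$ of $T$ is the average of the orders of all subtrees of $T$, i.e. (sum of the orders of all subtrees of $T$)/(number of subtrees of $T$). A tree of maximum mean subtree order in a given family of trees is called optimal in that family. Gluing a vertex $v$ of a graph to a vertex $u$ of a disjoint graph means identifying $v$ with $u$ (into a single vertex). A central vertex of a graph is a vertex of minimum eccentricity, where the eccentricity of a vertex is its greatest distance to any other vertex. *)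

(* Defs.v *)
From HB Require Import structures.
From mathcomp Require Import all_boot all_order all_algebra.

Set Implicit Arguments.
Unset Strict Implicit.
Unset Printing Implicit Defensive.

Import Order.TTheory GRing.Theory Num.Theory.

Record sgraph := SGraph {
  vertex :> finType;
  adj : rel vertex;
  adj_sym : symmetric adj;
  adj_irrefl : irreflexive adj
}.

Definition connected_graph (G : sgraph) : Prop :=
  forall x y : G, connect (@adj G) x y.

Definition acyclic (G : sgraph) : Prop :=
  forall c : seq G, 2 < size c -> ~ ucycle (@adj G) c.

Definition is_tree (G : sgraph) : Prop :=
  [/\ 0 < #|G|, connected_graph G & acyclic G].

Definition edges (G : sgraph) : {set {set G}} :=
  [set [set p.1; p.2] | p : G * G & adj p.1 p.2].

(* A subgraph is a pair (W, F) of a vertex set and an edge set; it need not be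
   induced. *)
Definition is_subgraph (G : sgraph) (S : {set G} * {set {set G}}) : bool :=
  (S.2 \subset edges G) && [forall f in S.2, f \subset S.1].

Definition subgraph_connected (G : sgraph) (S : {set G} * {set {set G}}) : bool :=
  [forall x in S.1, forall y in S.1,
     connect (fun a b => [set a; b] \in S.2) x y].

Definition subtrees (G : sgraph) : {set {set G} * {set {set G}}} :=
  [set S | [&& S.1 != set0, is_subgraph S & subgraph_connected S]].

Definition mean_subtree_order (G : sgraph) : rat :=
  ((\sum_(S in subtrees G) #|S.1|)%:R / #|subtrees G|%:R)%R.

Definition optimal (I : Type) (T : I -> sgraph) (s : I) : Prop :=
  forall t : I, (mean_subtree_order (T t) <= mean_subtree_order (T s))%R.

Definition walk (G : sgraph) (k : nat) (x y : G) : bool :=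
  [exists p : k.-tuple G, path (@adj G) x p && (last x p == y)].

(* Vertices in different components get the junk distance #|G|. *)
Definition dist (G : sgraph) (x y : G) : nat :=
  \big[minn/#|G|]_(k < #|G| | walk k x y) k.

Definition eccentricity (G : sgraph) (x : G) : nat := \max_(y : G) dist x y.

Definition central (G : sgraph) (x : G) : Prop :=
  forall y : G, eccentricity x <= eccentricity y.

Section PathGraph.
Variable n : nat.

Definition path_adj : rel 'I_n := fun i j => (i.+1 == j) || (j.+1 == i).

Lemma path_adj_sym : symmetric path_adj.
Proof. by move=> i j; rewrite /path_adj orbC. Qed.

Lemma path_adj_irrefl : irreflexive path_adj.
Proof. by move=> i; rewrite /path_adj orbb eqn_leq ltnn. Qed.

(* u_1 ... u_n, with u_k represented by the ordinal of value k - 1. *)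
Definition path_graph := SGraph path_adj_sym path_adj_irrefl.

End PathGraph.

Section Glue.
Variables (G H : sgraph) (u : G) (v : H).

Definition disjoint_adj : rel (G + H) := fun a b =>
  match a, b with
  | inl x, inl y => adj x y
  | inr x, inr y => adj x y
  | _, _ => false
  end.

(* The class {inl u, inr v} is represented by inl u, every other class is a
   singleton. *)
Definition glue_vertex : finType := {a : G + H | a != inr v}.

Definition glue_proj (a : G + H) : glue_vertex :=
  insubd (Sub (inl u) isT : glue_vertex) a.

Definition glue_adj : rel glue_vertex := fun x y =>
  [exists a, exists b,
     [&& glue_proj a == x, glue_proj b == y & disjoint_adj a b]].

Lemma val_glue_proj a : val (glue_proj a) = if a == inr v then inl u else a.
Proof. by rewrite /glue_proj val_insubd if_neg. Qed.

Lemma disjoint_adj_sym : symmetric disjoint_adj.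
Proof. by case=> x [] y //=; rewrite adj_sym. Qed.

Lemma glue_adj_sym : symmetric glue_adj.
Proof.
suff imp x y : glue_adj x y -> glue_adj y x by move=> x y; apply/idP/idP => /imp.
move=> /existsP[a /existsP[b /and3P[ax bx ab]]].
by apply/existsP; exists b; apply/existsP; exists a; rewrite ax bx disjoint_adj_sym.
Qed.

Lemma glue_adj_irrefl : irreflexive glue_adj.
Proof.
move=> x; apply/negbTE/negP => /existsP[a /existsP[b /and3P[/eqP<- /eqP/(congr1 val)]]].
rewrite !val_glue_proj; case: (eqVneq a (inr v)) => [->|_];
  case: (eqVneq b (inr v)) => [->|_] /=.
- by rewrite adj_irrefl.
- by move->.
- by move<-; case: a.
by move->; case: a => z /=; rewrite adj_irrefl.
Qed.

Definition glue : sgraph := SGraph glue_adj_sym glue_adj_irrefl.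

End Glue.

(* Main.v *)
Require Import Defs.
From HB Require Import structures.
From mathcomp Require Import all_boot all_order all_algebra.
From mathcomp Require Import zify ring lra.

Set Implicit Arguments.
Unset Strict Implicit.
Unset Printing Implicit Defensive.

(** Write N, R for the number and the total order of the subtrees of Q through
v, and N0, R0 for those of the subtrees avoiding v.  If v is glued to a vertex
of the path with k vertices on one side and l on the other, m = k + l = n - 1
and x = (k + 1)(l + 1), then exactly x subpaths go through the gluing vertex,
with average order (m + 2) / 2, and the mean subtree order of the glued tree is
a quotient of two affine functions of x,
[[
  ((R + N m/2 - (m+2)/2) x + R0 + (m+1)(m+2)(m+3)/6)
    / ((N - 1) x + N0 + (m+1)(m+2)/2),
]]
whose coefficients depend only on Q and n ([two_arms_totals]).  So the mean is
monotone in x, and it increases strictly as soon as the determinant of the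
coefficients is positive ([slope_gt0]), where N >= 2 because Q has an edge at v.  The one fact about Q needed for that is
that subtrees avoiding v are on average no larger than subtrees through v,
R0 N <= N0 R ([rest_mean_le_root_mean]).  Since k + l is fixed, x is larger
exactly when the larger of k and l, which is the eccentricity of the gluing
vertex in the path, is smaller ([product_le_max], [path_graph_ecc]).  Hence
comparing means is the same as comparing eccentricities ([glue_mean_le]), and
the maximizers are exactly the central vertices.

All counts come from one rule.  Let two disjoint vertex sets be joined by a
single edge v w.  A subtree through v either stays on the side of v or is a
subtree through v, a subtree through w and the edge between them; a subtree
avoiding v stays on one side ([through_bridge], [avoiding_bridge]).  Every
rooted tree is built from single vertices by such joins
([connected_represented]), so its four numbers are computed by recursion on a
construction term, and inequalities between them are proved by induction on
that term.  The construction term of the glued tree is the one of Q with two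
paths attached at the root ([represents_glue]). *)

(** * Subtrees of a graph with a bridge *)

Section Bridge.
Variable G : sgraph.
Implicit Types (v w x y : G) (D : {set G}) (F : {set {set G}})
  (S : {set G} * {set {set G}}).

Lemma mem_edges x y : ([set x; y] \in edges G) = adj x y.
Proof.
apply/imsetP/idP => [[[a b]] /[1!inE] /= ab E|xy]; last by exists (x, y); rewrite ?inE.
have : x \in [set a; b] by rewrite -E set21.
have : y \in [set a; b] by rewrite -E set22.
have : a \in [set x; y] by rewrite E set21.
have : b \in [set x; y] by rewrite E set22.
have abn : a != b.
  by apply: contraTneq ab => ->; rewrite adj_irrefl.
rewrite !inE; case/orP=> /eqP eb; case/orP=> /eqP ea; subst; rewrite ?eqxx // in abn *.
by rewrite adj_sym.
Qed.

Lemma subtreeP S :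
  reflect [/\ S.1 != set0, {subset S.2 <= edges G},
    {in S.2, forall e : {set G}, e \subset S.1}
    & {in S.1 &, forall x y, connect (fun a b => [set a; b] \in S.2) x y}]
  (S \in subtrees G).
Proof.
rewrite inE; apply: (iffP and3P).
  case=> -> /andP[/subsetP h1 /forall_inP h2] /forall_inP h3; split=> //.
  by move=> x y xS yS; have /forall_inP := h3 x xS; apply.
case=> -> h1 h2 h3; split=> //.
  by apply/andP; split; [apply/subsetP | apply/forall_inP].
by apply/forall_inP => x xS; apply/forall_inP => y yS; apply: h3.
Qed.

Lemma edge_subset x y D : ([set x; y] \subset D) = (x \in D) && (y \in D).
Proof. by rewrite subUset !sub1set. Qed.

Lemma connect_edge_sym F :
  connect_sym (fun a b : G => [set a; b] \in F).
Proof. by apply: sym_connect_sym => x y; rewrite setUC. Qed.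

Definition through v D := [set S in subtrees G | S.1 \subset D & v \in S.1].
Definition avoiding v D := [set S in subtrees G | S.1 \subset D & v \notin S.1].

Lemma throughP v D S :
  reflect [/\ S \in subtrees G, S.1 \subset D & v \in S.1] (S \in through v D).
Proof. by rewrite [S \in through _ _]inE; apply: and3P. Qed.

Lemma avoidingP v D S :
  reflect [/\ S \in subtrees G, S.1 \subset D & v \notin S.1]
    (S \in avoiding v D).
Proof. by rewrite [S \in avoiding _ _]inE; apply: and3P. Qed.

Definition restrict D S := (S.1 :&: D, [set e in S.2 | e \subset D]).

(** If [rho] retracts the graph onto [D] and sends every edge of [S] to an edge of
[S] inside [D] or to a single vertex, then it sends walks of [S] to walks of the
part of [S] inside [D], which is therefore connected. *)
Lemma restrict_subtree D v S (rho : G -> G) : S \in subtrees G ->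
  {in D, rho =1 id} ->
  (forall x y, [set x; y] \in S.2 -> rho x != rho y ->
    ([set rho x; rho y] \in S.2) && ([set rho x; rho y] \subset D)) ->
  v \in S.1 :&: D ->
  restrict D S \in subtrees G.
Proof.
case/subtreeP=> S0 SE SV SC rD rE vS; apply/subtreeP; split=> /=.
- by apply/set0Pn; exists v.
- by move=> e; rewrite inE => /andP[/SE].
- by move=> e; rewrite inE subsetI => /andP[/SV -> ->].
move=> x y; rewrite !inE => /andP[xS xD] /andP[yS yD].
rewrite -(rD x xD) -(rD y yD).
have /connectP[p] := SC x y xS yS.
elim: p x {xS xD} => [|z p IH] x /= => [_ ->|/andP[xz pz] Ey].
  exact: connect0.
apply: connect_trans (IH z pz Ey).
have [->|nxz] := eqVneq (rho x) (rho z); first exact: connect0.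
by apply: connect1; rewrite inE; apply: rE.
Qed.

Variables (D1 D2 : {set G}) (v w : G).
Hypotheses (dis : [disjoint D1 & D2]) (vD : v \in D1) (wD : w \in D2).
Hypothesis vw : adj v w.
Hypothesis cross : {in D1 & D2, forall x y, adj x y -> x = v /\ y = w}.

Let notD2 x : x \in D1 -> x \notin D2.
Proof. by move/(disjointFr dis)->. Qed.
Let notD1 x : x \in D2 -> x \notin D1.
Proof. by move/(disjointFl dis)->. Qed.

Lemma edge_cases S x y : S \in subtrees G -> S.1 \subset D1 :|: D2 ->
  [set x; y] \in S.2 ->
  [\/ x \in D1 /\ y \in D1, x \in D2 /\ y \in D2, x = v /\ y = w
    | x = w /\ y = v].
Proof.
case/subtreeP=> _ SE SV _ /subsetP SD xyS.
have := SV _ xyS; rewrite edge_subset => /andP[/SD + /SD].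
have := SE _ xyS; rewrite mem_edges !inE => a.
case/orP=> hx /orP[] hy; [by apply: Or41| | |by apply: Or42].
  by apply: Or43; apply: cross.
by apply: Or44; rewrite adj_sym in a; case: (cross hy hx a).
Qed.

(** Without the edge [v w], no edge of [S] leaves [D1]. *)
Lemma uncrossed S : S \in subtrees G -> S.1 \subset D1 :|: D2 ->
  [set v; w] \notin S.2 -> (S.1 \subset D1) || (S.1 \subset D2).
Proof.
move=> St SD nvw; have /subtreeP[/set0Pn[x xS] _ _ SC] := St.
have cl : closed (fun a b : G => [set a; b] \in S.2) D1.
  move=> a b ab; case: (edge_cases St SD ab) => -[ha hb].
  - by rewrite ha hb.
  - by rewrite !(negbTE (notD1 _)).
  - by rewrite -ha -hb ab in nvw.
  - by rewrite -ha -hb setUC ab in nvw.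
have eq y : y \in S.1 -> (y \in D1) = (x \in D1).
  by move=> yS; rewrite (closed_connect cl (SC x y xS yS)).
have [xD|xD] := boolP (x \in D1); apply/orP; [left|right]; apply/subsetP => y yS.
  by rewrite eq.
by have /(subsetP SD) := yS; rewrite inE eq // (negbTE xD).
Qed.

Definition bridge (p : ({set G} * {set {set G}}) * ({set G} * {set {set G}})) :=
  (p.1.1 :|: p.2.1, [set v; w] |: (p.1.2 :|: p.2.2)).

Lemma bridge_subtree S1 S2 : S1 \in through v D1 -> S2 \in through w D2 ->
  bridge (S1, S2) \in subtrees G.
Proof.
case/throughP=> /subtreeP[_ E1 V1 C1] sD1 vS.
case/throughP=> /subtreeP[_ E2 V2 C2] sD2 wS.
apply/subtreeP; split=> /=.
- by apply/set0Pn; exists v; rewrite inE vS.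
- by move=> e; rewrite !inE => /or3P[/eqP->|/E1|/E2] //; rewrite mem_edges.
- move=> e; rewrite !inE => /or3P[/eqP->|/V1|/V2].
  + by rewrite edge_subset !inE vS wS orbT.
  + by move=> h; apply: subset_trans h (subsetUl _ _).
  + by move=> h; apply: subset_trans h (subsetUr _ _).
set F := _ |: _.
have toroot x : x \in S1.1 :|: S2.1 ->
    connect (fun a b => [set a; b] \in F) x v.
  rewrite inE => /orP[xS|xS].
    apply: connect_sub (C1 x v xS vS) => a b ab; apply: connect1.
    by rewrite !inE ab orbT.
  apply: (@connect_trans _ _ w); last first.
    by apply: connect1; rewrite setUC !inE eqxx.
  apply: connect_sub (C2 x w xS wS) => a b ab; apply: connect1.
  by rewrite !inE ab !orbT.
move=> x y /toroot hx /toroot hy.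
by apply: connect_trans hx _; rewrite connect_edge_sym.
Qed.

Lemma restrict_bridge S1 S2 : S1 \in through v D1 -> S2 \in through w D2 ->
  restrict D1 (bridge (S1, S2)) = S1 /\ restrict D2 (bridge (S1, S2)) = S2.
Proof.
case: S1 S2 => [W1 F1] [W2 F2].
case/throughP=> /subtreeP[/= _ E1 V1 C1] sD1 vS.
case/throughP=> /subtreeP[/= _ E2 V2 C2] sD2 wS.
have nonempty F e : {subset F <= edges G} -> e \in F -> exists x, x \in e.
  by move=> h /h /imsetP[p _ ->]; exists p.1; rewrite set21.
rewrite /restrict /=; split; congr (_, _).
- rewrite setIUl (setIidPl sD1) [W2 :&: D1](_ : _ = set0) ?setU0 //.
  by apply/eqP; rewrite setI_eq0 (disjointWl sD2) // disjoint_sym.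
- apply/setP => e; rewrite !inE; apply/andP/idP => [[/or3P[/eqP->||] //]|eF].
  + by rewrite edge_subset (negbTE (notD1 wD)) andbF.
  + move=> eF eD; have [x xe] := nonempty _ _ E2 eF.
    have xD := subsetP (subset_trans (V2 e eF) sD2) x xe.
    by have := notD1 xD; rewrite (subsetP eD).
  + by rewrite eF orbT (subset_trans (V1 e eF)).
- rewrite setIUl (setIidPl sD2) [W1 :&: D2](_ : _ = set0) ?set0U //.
  by apply/eqP; rewrite setI_eq0 (disjointWl sD1).
- apply/setP => e; rewrite !inE; apply/andP/idP => [[/or3P[/eqP->||] //]|eF].
  + by rewrite edge_subset (negbTE (notD2 vD)).
  + move=> eF eD; have [x xe] := nonempty _ _ E1 eF.
    have xD := subsetP (subset_trans (V1 e eF) sD1) x xe.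
    by have := notD2 xD; rewrite (subsetP eD).
  + by rewrite eF !orbT (subset_trans (V2 e eF)).
Qed.

(** Each side of [S] is connected: collapse the other side to the end of the
bridge. *)
Lemma bridge_restrict S : S \in subtrees G -> S.1 \subset D1 :|: D2 ->
  [set v; w] \in S.2 ->
  [/\ restrict D1 S \in through v D1, restrict D2 S \in through w D2
    & S = bridge (restrict D1 S, restrict D2 S)].
Proof.
move=> St SD vwS; have /subtreeP[_ SE SV _] := St.
have /andP[vS wS] : (v \in S.1) && (w \in S.1) by rewrite -edge_subset SV.
split.
- apply/throughP; rewrite subsetIr in_setI vS vD; split=> //.
  apply: (@restrict_subtree D1 v S (fun x => if x \in D1 then x else v)) => //.
  + by move=> x /= ->.
  + move=> x y xy; case: (edge_cases St SD xy) => -[hx hy].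
    * by rewrite hx hy edge_subset hx hy xy.
    * by rewrite !(negbTE (notD1 _)) ?eqxx.
    * by rewrite hx hy vD (negbTE (notD1 wD)) eqxx.
    * by rewrite hx hy vD (negbTE (notD1 wD)) eqxx.
  + by rewrite inE vS.
- apply/throughP; rewrite subsetIr in_setI wS wD; split=> //.
  apply: (@restrict_subtree D2 w S (fun x => if x \in D2 then x else w)) => //.
  + by move=> x /= ->.
  + move=> x y xy; case: (edge_cases St SD xy) => -[hx hy].
    * by rewrite !(negbTE (notD2 _)) ?eqxx.
    * by rewrite hx hy edge_subset hx hy xy.
    * by rewrite hx hy wD (negbTE (notD2 vD)) eqxx.
    * by rewrite hx hy wD (negbTE (notD2 vD)) eqxx.
  + by rewrite inE wS.
rewrite /bridge /=; move: vwS SD; rewrite [S]surjective_pairing /= => vwS SD.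
congr (_, _); first by rewrite -setIUr (setIidPl SD).
apply/setP => e; rewrite !inE;
  apply/idP/or3P => [eS|[/eqP->|/andP[]|/andP[]]//].
have /imsetP[[x y] _ /= Ee] := SE e eS; rewrite eS Ee !edge_subset.
rewrite Ee in eS; case: (edge_cases St SD eS) => -[-> ->].
- by apply: Or32.
- by apply: Or33; rewrite andbT.
- by apply: Or31.
- by apply: Or31; rewrite setUC.
Qed.

(** Stated for an arbitrary weight [f] of the order, so that [f := fun=> 1] gives
numbers of subtrees and [f := id] gives their total orders. *)
Lemma through_bridge (f : nat -> nat) :
  \sum_(S in through v (D1 :|: D2)) f #|S.1| =
  \sum_(S in through v D1) f #|S.1| +
  \sum_(S1 in through v D1) \sum_(S2 in through w D2) f (#|S1.1| + #|S2.1|).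
Proof.
rewrite (bigID (fun S => [set v; w] \in S.2)) /= addnC; congr (_ + _).
  apply: eq_bigl => S; apply/andP/throughP.
    case=> /throughP[St SD vS] nvw; split=> //.
    case/orP: (uncrossed St SD nvw) => // /subsetP/(_ v vS) h.
    by rewrite (negbTE (notD2 vD)) in h.
  case=> St SD vS; split.
    by apply/throughP; split=> //; apply: subset_trans SD (subsetUl _ _).
  case/subtreeP: St => _ _ SV _; apply/negP => /SV; rewrite edge_subset vS /=.
  by move/(subsetP SD); apply/negP/notD1.
rewrite pair_big_dep /=.
set A := through v D1; set B := through w D2.
have -> : \sum_(p | (p.1 \in A) && (p.2 \in B)) f (#|p.1.1| + #|p.2.1|) =
          \sum_(p in setX A B) f #|(bridge p).1|.
  apply: eq_big => [p|p /andP[/throughP[_ s1 _] /throughP[_ s2 _]]].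
    by case: p => a b; rewrite in_setX.
  congr f; rewrite /= cardsU [_ :&: _](_ : _ = set0) ?cards0 ?subn0 //.
  by apply/eqP; rewrite setI_eq0 (disjointWl s1) // (disjointWr s2).
rewrite -(big_imset (h := bridge) (fun S => f #|S.1|)) /=; last first.
  move=> [a b] [c d] /setXP[/= aA bB] /setXP[/= cA dB] E.
  have [h1 h2] := restrict_bridge aA bB; have [h3 h4] := restrict_bridge cA dB.
  by move: h1 h2; rewrite E h3 h4 => -> ->.
apply: eq_bigl => S; apply/andP/imsetP.
  case=> /throughP[St SD vS] vwS.
  have [h1 h2 h3] := bridge_restrict St SD vwS.
  by exists (restrict D1 S, restrict D2 S) => //; rewrite in_setX h1.
case=> [[a b]] /setXP[/= aA bB] ->; split; last by rewrite !inE eqxx.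
apply/throughP; split; first exact: bridge_subtree.
  by case/throughP: aA bB => _ ? _ /throughP[_ ? _]; apply: setUSS.
by case/throughP: aA => _ _ h; rewrite inE h.
Qed.

Lemma avoiding_bridge (f : nat -> nat) :
  \sum_(S in avoiding v (D1 :|: D2)) f #|S.1| =
  \sum_(S in avoiding v D1) f #|S.1| +
  (\sum_(S in through w D2) f #|S.1| + \sum_(S in avoiding w D2) f #|S.1|).
Proof.
rewrite (bigID (fun S => S.1 \subset D1)) /=; congr (_ + _).
  apply: eq_bigl => S; apply/andP/avoidingP => [[/avoidingP[]] //|[St SD vS]].
  by split=> //; apply/avoidingP; split=> //; apply: subset_trans SD (subsetUl _ _).
rewrite [RHS](_ : _ = \sum_(S in subtrees G | S.1 \subset D2) f #|S.1|).
  apply: eq_bigl => S; apply/andP/andP.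
    case=> /avoidingP[St SD vS] nD; split=> //.
    have nvw : [set v; w] \notin S.2.
      case/subtreeP: St => _ _ SV _; apply/negP => /SV.
      by rewrite edge_subset (negbTE vS).
    by have := uncrossed St SD nvw; rewrite (negbTE nD).
  case=> St SD; split.
    apply/avoidingP; split=> //; first exact: subset_trans SD (subsetUr _ _).
    by apply: contra (notD2 vD) => /(subsetP SD).
  (* a subtree is nonempty, so one inside D2 is not inside D1 *)
  case/subtreeP: St => /set0Pn[x xS] _ _ _.
  by apply/subsetPn; exists x => //; apply/notD1/(subsetP SD).
rewrite [RHS](bigID (fun S => w \in S.1)) /=; congr (_ + _);
  apply: eq_bigl => S.
  by rewrite [S \in through _ _]inE andbA.
by rewrite [S \in avoiding _ _]inE andbA.
Qed.

End Bridge.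

(** * Rooted trees built by grafting *)

(** Construction terms of rooted trees: [Graft t1 t2] joins the roots of [t1] and
[t2] by an edge and keeps the root of [t1].  Unlike the recursion over the list
of branches at the root, this binary one has a single step to analyse. *)
Inductive rtree := Root | Graft (t1 t2 : rtree).

(** Number ([nroot]) and total order ([oroot]) of the subtrees through the root,
number ([nrest]) and total order ([orest]) of the subtrees avoiding it; see
[represents_counts]. *)
Fixpoint nroot t :=
  if t is Graft t1 t2 then nroot t1 * (nroot t2).+1 else 1.
Fixpoint oroot t :=
  if t is Graft t1 t2 then oroot t1 * (nroot t2).+1 + nroot t1 * oroot t2
  else 1.
Fixpoint nrest t :=
  if t is Graft t1 t2 then nrest t1 + (nroot t2 + nrest t2) else 0.
Fixpoint orest t :=
  if t is Graft t1 t2 then orest t1 + (oroot t2 + orest t2) else 0.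

Lemma nroot_gt0 t : 0 < nroot t.
Proof. by elim: t => //= t1 h1 t2 h2; rewrite muln_gt0 h1. Qed.

Lemma nroot_le_oroot t : nroot t <= oroot t.
Proof.
elim: t => //= t1 h1 t2 h2.
by apply: leq_trans (leq_addr _ _); rewrite leq_mul2r h1 orbT.
Qed.

(** A subtree through the root has at most as many vertices as the tree, and the
paths from the root show that there are at least that many subtrees through the
root; here this is obtained from the recursion. *)
Lemma oroot_le_sq t : oroot t <= nroot t * nroot t.
Proof.
elim: t => //= t1 h1 t2 h2.
have := nroot_gt0 t1; have := nroot_gt0 t2.
move: (nroot t1) (oroot t1) (nroot t2) (oroot t2) h1 h2 => K k M m h1 h2 M0 K0.
have e1 : k * M.+1 <= K * K * M.+1 by rewrite leq_mul2r h1 orbT.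
have e2 : K * m <= K * (M * M) by rewrite leq_mul2l h2 orbT.
have e3 : K * (M * M) <= K * K * (M * M) by rewrite leq_mul2r leq_pmulr ?orbT.
nia.
Qed.

(** Jamison's comparison of the local and the global mean.  For [Graft t1 t2] the
subtrees avoiding the root are those of [t1], whose mean is at most
[oroot t1 / nroot t1] and thus at most the new root mean, and all those of [t2],
whose mean is at most [oroot t2 / nroot t2].  The latter is at most
[oroot t1 / nroot t1 + oroot t2 / (nroot t2).+1], the new root mean, by
[oroot_le_sq] for [t2], because the first summand is at least 1. *)
Lemma rest_mean_le_root_mean t : orest t * nroot t <= nrest t * oroot t.
Proof.
elim: t => //= t1 h1 t2 h2.
have := nroot_gt0 t2; have := nroot_le_oroot t1; have := oroot_le_sq t2.
move: (nroot t1) (oroot t1) (nrest t1) (orest t1) h1 => K k K0 k0 h1.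
move: (nroot t2) (oroot t2) (nrest t2) (orest t2) h2 => M m M0 m0 h2 h3 h4 h5.
have e1 : k0 * K * M.+1 <= K0 * k * M.+1 by rewrite leq_mul2r h1 orbT.
have e2 : (m + m0) * (K * M.+1) <= (M + M0) * (k * M.+1 + K * m).
  rewrite -(leq_pmul2l h5).
  have f1 : M * (m + m0) <= (M + M0) * m by rewrite mulnDr mulnDl; lia.
  have f2 : m * (K * M.+1) <= M * (k * M.+1 + K * m).
    have : m * K <= M * M * k by apply: leq_mul.
    have : M * M * k <= M * k * M.+1 by nia.
    nia.
  apply: (@leq_trans ((M + M0) * (m * (K * M.+1)))).
    by rewrite [leqLHS]mulnA [leqRHS]mulnA leq_mul2r f1 orbT.
  by rewrite [leqRHS]mulnCA leq_mul2l f2 orbT.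
nia.
Qed.

(** [represents t D v]: the part of the graph on the vertex set [D] is a tree with
root [v], built as [t] prescribes. *)
Inductive represents (G : sgraph) : rtree -> {set G} -> G -> Prop :=
| represents_root v : represents Root [set v] v
| represents_graft t1 t2 (D1 D2 : {set G}) v w :
    represents t1 D1 v -> represents t2 D2 w ->
    [disjoint D1 & D2] -> adj v w ->
    {in D1 & D2, forall x y, adj x y -> x = v /\ y = w} ->
    represents (Graft t1 t2) (D1 :|: D2) v.

Lemma represents_mem (G : sgraph) t (D : {set G}) v :
  represents t D v -> v \in D.
Proof. by elim=> [u|*]; rewrite ?set11 // inE; apply/orP; left. Qed.

Lemma through_single (G : sgraph) (v : G) :
  through v [set v] = [set ([set v], set0)].
Proof.
apply/setP => S; rewrite [RHS]inE; apply/throughP/eqP.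
  case: S => W F [/subtreeP[_ /= E V _] sW vW].
  have eW : W = [set v] by apply/eqP; rewrite eqEsubset sW sub1set.
  rewrite eW; congr (_, _); apply/setP => e; rewrite inE; apply/negP => eF.
  have /imsetP[[x y] + /= ee] := E e eF.
  rewrite inE /=; have := V e eF.
  rewrite ee edge_subset eW !inE => /andP[/eqP-> /eqP->].
  by rewrite adj_irrefl.
move->; split; rewrite ?set11 //; apply/subtreeP; split=> /=.
- by apply/set0Pn; exists v; rewrite set11.
- by move=> e; rewrite inE.
- by move=> e; rewrite inE.
by move=> x y /set1P-> /set1P->.
Qed.

Lemma avoiding_single (G : sgraph) (v : G) : avoiding v [set v] = set0.
Proof.
apply/setP => S; rewrite [RHS]inE; apply/avoidingP => -[].
case/subtreeP=> /set0Pn[x xS] _ _ _ /subsetP sD.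
by have /set1P <- := sD x xS; rewrite xS.
Qed.

Lemma represents_counts (G : sgraph) t (D : {set G}) v : represents t D v ->
  [/\ #|through v D| = nroot t, \sum_(S in through v D) #|S.1| = oroot t,
      #|avoiding v D| = nrest t & \sum_(S in avoiding v D) #|S.1| = orest t].
Proof.
elim=> [{}v|t1 t2 D1 D2 {}v w r1 [n1 o1 m1 p1] r2 [n2 o2 m2 p2] dis vw cr].
  by rewrite through_single avoiding_single cards1 cards0 big_set1 big_set0 cards1.
have vD := represents_mem r1; have wD := represents_mem r2.
have tb := through_bridge dis vD wD vw cr.
have ab := avoiding_bridge dis vD cr.
split=> /=.
- rewrite -sum1_card (tb (fun=> 1)) sum1_card n1.
  rewrite (eq_bigr (fun=> nroot t2)) => [|i _]; last by rewrite sum1_card.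
  by rewrite sum_nat_const n1 mulnS.
- rewrite (tb id) o1.
  rewrite (eq_bigr (fun S1 : {set G} * {set {set G}} =>
    #|S1.1| * nroot t2 + oroot t2)) => [|S _].
    by rewrite big_split /= -big_distrl /= sum_nat_const n1 o1 mulnS addnA.
  by rewrite big_split /= sum_nat_const n2 o2 mulnC.
- by rewrite -sum1_card (ab (fun=> 1)) !sum1_card n2 m1 m2.
by rewrite (ab id) o2 p1 p2.
Qed.

Definition mean_order t : rat :=
  ((oroot t + orest t)%:R / (nroot t + nrest t)%:R)%R.

Lemma represents_mean (G : sgraph) t (v : G) :
  represents t setT v -> mean_subtree_order G = mean_order t.
Proof.
case/represents_counts=> n1 o1 m1 p1; rewrite /mean_subtree_order /mean_order.
have split_sum (f : nat -> nat) : \sum_(S in subtrees G) f #|S.1| =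
    \sum_(S in through v setT) f #|S.1| + \sum_(S in avoiding v setT) f #|S.1|.
  rewrite (bigID (fun S : {set G} * {set {set G}} => v \in S.1)) /=.
  by congr (_ + _); apply: eq_bigl => S;
    [rewrite [S \in through _ _]inE | rewrite [S \in avoiding _ _]inE];
    rewrite subsetT.
by rewrite -sum1_card (split_sum id) (split_sum (fun=> 1)) !sum1_card n1 o1 m1 p1.
Qed.

Lemma represents_embed (G H : sgraph) (f : G -> H) t (D : {set G}) v :
  injective f -> (forall x y, adj (f x) (f y) = adj x y) ->
  represents t D v -> represents t (f @: D) (f v).
Proof.
move=> fI fA; elim=> [{}v|t1 t2 D1 D2 {}v w r1 h1 r2 h2 dis vw cr].
  by rewrite imset_set1; constructor.
rewrite imsetU; apply: represents_graft h1 h2 _ _ _; last 1 first.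
- move=> _ _ /imsetP[x xD ->] /imsetP[y yD ->]; rewrite fA => xy.
  by case: (cr x y xD yD xy) => -> ->.
- by rewrite imset_disjoint.
by rewrite fA.
Qed.

(** * Every tree is built by grafting *)

(** Adjacency in the subgraph induced on [A]. *)
Definition radj (G : sgraph) (A : {set G}) : rel G :=
  fun x y => [&& x \in A, y \in A & adj x y].

Lemma radj_sym (G : sgraph) (A : {set G}) : connect_sym (radj A).
Proof.
by apply: sym_connect_sym => x y; rewrite /radj adj_sym andbCA.
Qed.

Lemma connect_reachable (T : finType) (r : rel T) w x : connect r w x ->
  connect (fun a b => [&& connect r w a, connect r w b & r a b]) w x.
Proof.
move=> /connectP[p pw ->]; elim/last_ind: p pw => [|p y IH] /=.
  by move=> _; exact: connect0.
rewrite rcons_path last_rcons => /andP[pw ry].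
apply: connect_trans (IH pw) (connect1 _).
have c1 : connect r w (last w p) by apply/connectP; exists p.
by rewrite c1 ry (connect_trans c1) // connect1.
Qed.

(** Cut an edge from [v] to a neighbour [w]: [D2] collects the vertices reachable
from [w] without passing through [v], and [D1] is the rest.  A second edge
between the two parts would close a cycle through [v]. *)
Lemma connected_represented (G : sgraph) (D : {set G}) v : acyclic G ->
  v \in D -> {in D, forall x, connect (radj D) v x} ->
  exists t, represents t D v.
Proof.
move=> acyc; have [k] := ubnP #|D|; elim: k D v => // k IH D v /ltnSE leD vD con.
have [/eqP D1|] := boolP (D == [set v]).
  by exists Root; rewrite D1; constructor.
rewrite eq_sym eqEsubset sub1set vD => /subsetPn[x xD]; rewrite inE => xv.
have /connectP[[/= _ E|w _ /= /andP[/and3P[_ wD vw] _] _]] := con x xD.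
  by rewrite E eqxx in xv.
have wv : w != v by apply: contraTneq vw => ->; rewrite adj_irrefl.
pose D' := D :\ v.
pose D2 := [set x | connect (radj D') w x].
have sD2 : {subset D2 <= D'}.
  move=> y; rewrite inE radj_sym => /connectP[[|z q] /= + E].
    by rewrite -E => _; rewrite !inE wv.
  by case/andP=> /and3P[].
have wD2 : w \in D2 by rewrite inE connect0.
have vD2 : v \notin D2 by apply/negP => /sD2; rewrite !inE eqxx.
pose D1 := D :\: D2.
have D12 : D = D1 :|: D2.
  apply/setP => y; rewrite !inE; case: (boolP (connect _ _ _)) => //= c.
    by have /sD2 : y \in D2; rewrite ?inE // => /andP[_ ->].
  by rewrite orbF.
have vD1 : v \in D1 by rewrite inE vD vD2.
have dis : [disjoint D1 & D2].
  by rewrite disjoint_sym disjoints_subset; apply/subsetP => y; rewrite !inE => ->.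
have step y z : y \in D2 -> z \in D -> z != v -> adj y z -> z \in D2.
  move=> yD2 zD zv yz; have := yD2; rewrite !inE => /connect_trans; apply.
  by apply: connect1; rewrite /radj sD2 // !inE zv zD.
have size_lt : #|D1| + #|D2| = #|D|.
  by rewrite D12 cardsU (disjoint_setI0 dis) cards0 subn0.
have [t2 r2] : exists t, represents t D2 w.
  apply: IH => //.
    apply: leq_trans leD; rewrite -size_lt -[ltnLHS]add0n ltn_add2r.
    by apply/card_gt0P; exists v.
  move=> y; rewrite inE => /connect_reachable; apply: connect_sub => a b.
  case/and3P=> wa wb /and3P[_ _ ab]; apply: connect1.
  by rewrite /radj !inE wa wb.
(* a walk in D from D1 to v stays in D1, since D2 is left only through v *)
have [t1 r1] : exists t, represents t D1 v.
  apply: IH => //.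
    apply: leq_trans leD; rewrite -size_lt -[ltnLHS]addn0 ltn_add2l.
    by apply/card_gt0P; exists w.
  move=> y yD1; have yD : y \in D by case/setDP: yD1.
  have := con y yD; rewrite [connect (radj D) _ _]radj_sym.
  rewrite [connect (radj D1) _ _]radj_sym => /connectP[p].
  elim: p y yD1 {yD} => [|z p IHp] y yD1 /= => [_ ->|]; first exact: connect0.
  case/andP=> /and3P[yD zD yz] pz ev.
  have [->|yv] := eqVneq y v; first exact: connect0.
  have zD1 : z \in D1.
    rewrite inE zD andbT; apply/negP => zD2.
    case/setDP: yD1 => _ /negP; apply; apply: step zD2 yD yv _.
    by rewrite adj_sym.
  apply: connect_trans (IHp z zD1 pz ev); apply: connect1.
  by rewrite /radj yD1 zD1.
exists (Graft t1 t2); rewrite D12; apply: (represents_graft r1 r2 dis vw).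
move=> a b /setDP[aD aD2] bD2 ab.
have av : a = v.
  apply/eqP; apply: contraNT aD2 => av; apply: step bD2 aD av _.
  by rewrite adj_sym.
rewrite av in ab *; split=> //; apply/eqP; rewrite eq_sym; apply/negPn/negP => wb.
(* the second edge v b and a simple path from w to b avoiding v form a cycle *)
have : connect (radj D') w b by rewrite inE in bD2.
case/connectP=> q0 pq0 lq0; case/shortenP: pq0 lq0 => q pq uq _ lq.
apply: (acyc (v :: w :: q)).
  by case: q lq {pq uq} => // E; rewrite E eqxx in wb.
have qD' : {subset w :: q <= D'}.
  move=> y; rewrite inE => /predU1P[->|]; first by rewrite !inE wv.
  move: pq; elim: (q) (w) => // z q' IHq u /= /andP[/and3P[_ zD _] pz].
  by rewrite inE => /predU1P[->|/(IHq z pz)].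
apply/andP; split.
  rewrite /= vw rcons_path -lq adj_sym ab andbT /=.
  by apply: sub_path pq => c d /and3P[].
rewrite cons_uniq uq andbT; apply/negP => /qD'.
by rewrite !inE eqxx.
Qed.

Lemma tree_represented (Q : sgraph) (v : Q) : is_tree Q ->
  exists t, represents t setT v.
Proof.
case=> _ con acyc; apply: connected_represented => // x _.
by apply: connect_sub (con v x) => a b ab; apply: connect1; rewrite /radj !inE.
Qed.

(** * A rooted tree with two paths attached *)

(** [t] with a path of [k] new vertices attached at its root; in particular
[attach Root k] is a path of [k.+1] vertices rooted at an end. *)
Fixpoint attach t k := if k is k'.+1 then Graft t (attach Root k') else t.

(** Case [k = 0] is included so that gluing at an end of the path needs no separate
treatment. *)
Lemma represents_attach (G : sgraph) t (D D' : {set G}) v k :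
  represents t D v -> [disjoint D & D'] ->
  (if k is k'.+1 then exists w, [/\ represents (attach Root k') D' w, adj v w
     & {in D & D', forall x y, adj x y -> x = v /\ y = w}] else D' = set0) ->
  represents (attach t k) (D :|: D') v.
Proof.
move=> r dis; case: k => [->|k [w [rw vw cr]]]; first by rewrite setU0.
exact: (represents_graft r rw).
Qed.

Lemma attach_counts t k :
  [/\ nroot (attach t k) = nroot t * k.+1,
      oroot (attach t k) = oroot t * k.+1 + nroot t * 'C(k.+1, 2),
      nrest (attach t k) = nrest t + 'C(k.+1, 2)
    & orest (attach t k) = orest t + 'C(k.+2, 3)].
Proof.
elim: k t => [|k IH] t /=.
  by rewrite !bin_small // !muln1 muln0 !addn0.
have [-> -> -> ->] := IH Root.
rewrite /= !mul1n !add0n (binS k.+2 2) (binS k.+1 1) bin1.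
by split; ring.
Qed.

Section Arithmetic.
Import Order.TTheory GRing.Theory Num.Theory.
Local Open Scope ring_scope.

Lemma bin2_rat k : 'C(k.+1, 2)%:R = k%:R * (k%:R + 1) / 2 :> rat.
Proof.
elim: k => [|k IH]; first by rewrite bin_small // mul0r.
by rewrite binS bin1 natrD IH -natr1; field.
Qed.

Lemma bin3_rat k :
  'C(k.+2, 3)%:R = k%:R * (k%:R + 1) * (k%:R + 2) / 6 :> rat.
Proof.
elim: k => [|k IH]; first by rewrite bin_small // !mul0r.
by rewrite binS natrD IH bin2_rat -natr1; field.
Qed.

(** The determinant of the affine quotient giving the mean.  Apart from terms
whose sum is positive, as [2 <= N] and [2 <= m], it is
[(N - 1) ((m+2)/2 N0 - R0) + (R - N) N0], where [R0 <= N0 R / N]; since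
[(m+2)/2 >= 2], multiplying by [N] bounds this from below by
[N0 (N (N - 2) + R)]. *)
Lemma slope_gt0 (N R N0 R0 m : rat) : 2 <= N -> N <= R -> 0 <= N0 ->
  R0 * N <= N0 * R -> 2 <= m ->
  0 < (R + N * m / 2 - (m + 2) / 2) * (N0 + (m + 1) * (m + 2) / 2)
    - (R0 + (m + 1) * (m + 2) * (m + 3) / 6) * (N - 1).
Proof.
move=> N2 NR N00 RN m2.
rewrite [ltRHS](_ : _ = (N - 1) * ((m + 2) / 2 * N0 - R0) + (R - N) * N0
  + ((N - 1) * ((m + 1) * (m + 2) * m / 12)
     + (R - N) * ((m + 1) * (m + 2) / 2))); last by field.
have N_gt0 : 0 < N by lra.
have m3 : 0 < (m + 1) * (m + 2) by apply: mulr_gt0; lra.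
apply: ltr_wpDl; last first.
  apply: ltr_pwDl.
    by apply: mulr_gt0; [lra|apply: divr_gt0 => //; apply: mulr_gt0 => //; lra].
  by apply: mulr_ge0; [lra|apply: ltW; apply: divr_gt0].
rewrite -(pmulr_rge0 _ N_gt0).
have h1 : 0 <= (N - 1) * (N0 * R - R0 * N) by apply: mulr_ge0; lra.
have h2 : 0 <= (N - 1) * N * N0 * (m - 2).
  by rewrite !mulr_ge0 //; lra.
have h3 : 0 <= N0 * (N * (N - 2) + R).
  apply: mulr_ge0 => //; apply: addr_ge0; last by lra.
  by apply: mulr_ge0; lra.
lra.
Qed.

(** The binomial sums of the two attached paths depend, for fixed [k + l], only on
the product [(k + 1)(l + 1)]. *)
Lemma two_arms_totals t k l (x := ((k.+1 * l.+1)%N%:R : rat))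
    (m := ((k + l)%N%:R : rat)) :
  (oroot (attach (attach t k) l) + orest (attach (attach t k) l))%:R =
    ((oroot t)%:R + (nroot t)%:R * m / 2 - (m + 2) / 2) * x
    + ((orest t)%:R + (m + 1) * (m + 2) * (m + 3) / 6)
  /\ (nroot (attach (attach t k) l) + nrest (attach (attach t k) l))%:R =
    ((nroot t)%:R - 1) * x + ((nrest t)%:R + (m + 1) * (m + 2) / 2).
Proof.
have [-> -> -> ->] := attach_counts (attach t k) l.
have [-> -> -> ->] := attach_counts t k.
rewrite /x /m.
move: (bin2_rat k) (bin2_rat l) (bin3_rat k) (bin3_rat l).
(* abstracted, because natrD would otherwise unfold binomials into sums *)
move: 'C(k.+1, 2) 'C(l.+1, 2) 'C(k.+2, 3) 'C(l.+2, 3) => a b c d Ea Eb Ec Ed.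
by rewrite !(natrD, natrM) Ea Eb Ec Ed -!natr1; split; field.
Qed.

Lemma two_arms_mean_le t k l k' l' : (1 < nroot t)%N ->
  (k + l = k' + l')%N -> (2 <= k + l)%N ->
  (mean_order (attach (attach t k) l) <= mean_order (attach (attach t k') l'))
  = (k.+1 * l.+1 <= k'.+1 * l'.+1)%N.
Proof.
move=> t2 kl kl2.
have [o1 n1] := two_arms_totals t k l; have [o2 n2] := two_arms_totals t k' l'.
have pos s : 0 < (nroot s + nrest s)%:R :> rat.
  by rewrite ltr0n addn_gt0 nroot_gt0.
rewrite /mean_order ler_pdivrMr // mulrAC ler_pdivlMr // o1 n1 o2 n2 -kl.
rewrite -subr_ge0 -(ler_nat rat) -[RHS]subr_ge0.
set x := (k.+1 * l.+1)%N%:R; set y := (k'.+1 * l'.+1)%N%:R.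
set m := (k + l)%N%:R.
have s := @slope_gt0 (nroot t)%:R (oroot t)%:R (nrest t)%:R (orest t)%:R m.
rewrite -[RHS](pmulr_rge0 _ (s _ _ _ _ _)).
- by congr (_ <= _); ring.
- by rewrite ler_nat.
- by rewrite ler_nat nroot_le_oroot.
- exact: ler0n.
- by rewrite -!natrM ler_nat rest_mean_le_root_mean.
by rewrite ler_nat.
Qed.

End Arithmetic.

(** For a fixed sum, a product is larger when its factors are closer. *)
Lemma product_le_max k l k' l' : k + l = k' + l' ->
  (k.+1 * l.+1 <= k'.+1 * l'.+1) = (maxn k' l' <= maxn k l).
Proof.
wlog kl : k l / k <= l.
  move=> H E; case/orP: (leq_total k l) => c; first exact: H.
  by rewrite (mulnC k.+1) (maxnC k); apply: H => //; rewrite addnC.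
wlog kl' : k' l' / k' <= l'.
  move=> H E; case/orP: (leq_total k' l') => c; first exact: H.
  by rewrite (mulnC k'.+1) (maxnC k'); apply: H => //; rewrite E addnC.
move=> E; rewrite (maxn_idPr kl) (maxn_idPr kl').
apply/idP/idP; last by nia.
by apply: contraTT; rewrite -!ltnNge; nia.
Qed.

(** * Path graphs *)

Lemma bigmin_le (I : eqType) (r : seq I) (P : pred I) (F : I -> nat) x0 (i : I) :
  i \in r -> P i -> \big[minn/x0]_(j <- r | P j) F j <= F i.
Proof.
elim: r => // a r IH; rewrite inE big_cons => /predU1P[->|ir] Pi.
  by rewrite Pi geq_minl.
by case: ifP => _; [apply: leq_trans (geq_minr _ _) _|]; apply: IH.
Qed.

Section PathGraph.
Variable n : nat.
Implicit Types i j : path_graph n.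

Lemma represents_lower k i : i = k :> nat ->
  represents (attach Root k) [set x : path_graph n | x <= i] i.
Proof.
elim: k i => [|k IH] i ik.
  rewrite [X in represents _ X](_ : _ = [set i]); first by constructor.
  by apply/setP => x; rewrite !inE -val_eqE /= ik leqn0.
have kn : k < n by rewrite (ltn_trans _ (ltn_ord i)) // ik.
rewrite [X in represents _ X](_ : _ =
    [set i] :|: [set x : path_graph n | x <= Ordinal kn]); last first.
  by apply/setP => x; rewrite !inE -val_eqE /= ik leq_eqVlt ltnS.
apply: represents_attach; first by constructor.
  by rewrite disjoints1 inE /= ik ltnn.
exists (Ordinal kn); split; first exact: IH.
  by rewrite /= /path_adj /= ik eqxx orbT.
move=> x y /set1P->; rewrite inE /= /path_adj => yk xy; split=> //.
by apply: val_inj => /=; lia.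
Qed.

Lemma represents_upper k i : i + k.+1 = n ->
  represents (attach Root k) [set x : path_graph n | i <= x] i.
Proof.
elim: k i => [|k IH] i ik.
  rewrite [X in represents _ X](_ : _ = [set i]); first by constructor.
  apply/setP => x; rewrite !inE -val_eqE /=.
  by have := ltn_ord x; lia.
have kn : i.+1 < n by lia.
rewrite [X in represents _ X](_ : _ =
    [set i] :|: [set x : path_graph n | Ordinal kn <= x]); last first.
  by apply/setP => x; rewrite !inE -val_eqE /= leq_eqVlt eq_sym.
apply: represents_attach; first by constructor.
  by rewrite disjoints1 inE /= ltnn.
exists (Ordinal kn); split; first by apply: IH => /=; lia.
  by rewrite /= /path_adj /= eqxx.
move=> x y /set1P->; rewrite inE /= /path_adj => yk xy; split=> //.
by apply: val_inj => /=; lia.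
Qed.

(** The index changes by exactly one along an edge. *)
Lemma path_dist_le i p : path (@adj (path_graph n)) i p ->
  (i <= last i p + size p) && (last i p <= i + size p).
Proof.
elim: p i => [|j p IH] i; first by rewrite !addn0 leqnn.
rewrite [path _ _ _]/= => /andP[+ /IH]; rewrite /path_adj.
rewrite -[last i (j :: p)]/(last j p) -[size (j :: p)]/(size p).+1.
by lia.
Qed.

Lemma walk_exists k i j : (i + k == j) || (j + k == i) -> walk k i j.
Proof.
move=> h; suff [p sp [pp lp]] : exists2 p : seq (path_graph n),
    size p = k & path (@adj (path_graph n)) i p /\ last i p = j.
  by apply/existsP; exists (tcast sp (in_tuple p)); rewrite val_tcast pp lp eqxx.
elim: k i h => [|k IH] i h.
  by exists [::] => //; split=> //; apply: val_inj => /=; lia.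
have [z /andP[iz zj]] :
    exists z : path_graph n, adj i z && ((z + k == j) || (j + k == z)).
  have := ltn_ord i; have := ltn_ord j; case/orP: h => h jn i_n.
    have zn : i.+1 < n by lia.
    by exists (Ordinal zn); rewrite /= /path_adj /=; lia.
  have zn : i.-1 < n by lia.
  by exists (Ordinal zn); rewrite /= /path_adj /=; lia.
have [p sp [pp lp]] := IH z zj.
by exists (z :: p); [rewrite /= sp | split=> //; apply/andP; split].
Qed.

Lemma path_graph_dist i j : dist i j = (i - j) + (j - i).
Proof.
have ji := ltn_ord i; have jj := ltn_ord j.
apply/eqP; rewrite eqn_leq /dist; apply/andP; split.
  have dn : (i - j) + (j - i) < #|path_graph n| by rewrite /= card_ord; lia.
  apply: (@bigmin_le _ _ _ _ _ (Ordinal dn)); first exact: mem_index_enum.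
  by apply: walk_exists => /=; lia.
apply: (big_ind (leq ((i - j) + (j - i)))).
- by rewrite /= card_ord; lia.
- by move=> x y hx hy; rewrite leq_min hx.
move=> k /existsP[p /andP[/path_dist_le + /eqP e]].
by rewrite e size_tuple; lia.
Qed.

Lemma path_graph_ecc i : eccentricity i = maxn i (n.-1 - i).
Proof.
have i_n := ltn_ord i.
apply/eqP; rewrite eqn_leq /eccentricity; apply/andP; split.
  by apply/bigmax_leqP => j _; have := ltn_ord j; rewrite path_graph_dist; lia.
have n0 : 0 < n by lia.
have n1 : n.-1 < n by lia.
rewrite geq_max; apply/andP; split.
  have := @leq_bigmax _ (fun j : path_graph n => dist i j) (Ordinal n0).
  by rewrite path_graph_dist /= sub0n subn0 addn0.
have := @leq_bigmax _ (fun j : path_graph n => dist i j) (Ordinal n1).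
by apply: leq_trans; rewrite path_graph_dist /= leq_addl.
Qed.

End PathGraph.

(** * Gluing *)

Section Glue.
Variables (G H : sgraph) (u : G) (v : H).
Let T := glue u v.
Definition in_left (x : G) : T := glue_proj u v (inl x).
Definition in_right (y : H) : T := glue_proj u v (inr y).

Lemma val_in_left x : val (in_left x) = inl x.
Proof. by rewrite /in_left val_glue_proj. Qed.

Lemma val_in_right y : val (in_right y) = if y == v then inl u else inr y.
Proof. by rewrite /in_right val_glue_proj. Qed.

Lemma in_right_root : in_right v = in_left u.
Proof. by apply: val_inj; rewrite val_in_left val_in_right eqxx. Qed.

Lemma in_left_inj : injective in_left.
Proof. by move=> x y /(congr1 val); rewrite !val_in_left => -[]. Qed.

Lemma in_right_inj : injective in_right.
Proof.
move=> x y /(congr1 val); rewrite !val_in_right.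
by case: eqVneq => [->|_]; case: eqVneq => [->|_] // -[].
Qed.

Lemma in_left_right x y : in_left x = in_right y -> x = u /\ y = v.
Proof.
move/(congr1 val); rewrite val_in_left val_in_right.
by case: eqVneq => [->|_] // -[].
Qed.

Lemma glue_vertexP (z : T) :
  (exists x, z = in_left x) \/ (exists2 y, y != v & z = in_right y).
Proof.
case: z => [[x|y] h].
  by left; exists x; apply: val_inj; rewrite val_in_left.
have yv : y != v by apply: contraNneq h => ->.
by right; exists y => //; apply: val_inj; rewrite val_in_right (negbTE yv).
Qed.

Lemma glue_adjP (z1 z2 : T) : adj z1 z2 ->
  (exists x1 x2, [/\ z1 = in_left x1, z2 = in_left x2 & adj x1 x2]) \/
  (exists y1 y2, [/\ z1 = in_right y1, z2 = in_right y2 & adj y1 y2]).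
Proof.
case/existsP=> -[a|a] /existsP[[b|b] /and3P[/eqP<- /eqP<- ab]] //.
  by left; exists a, b.
by right; exists a, b.
Qed.

Lemma adj_in_left x y : adj (in_left x) (in_left y) = adj x y.
Proof.
apply/idP/idP => [/glue_adjP[[a [b [/in_left_inj-> /in_left_inj->]]] //|]|xy].
  case=> a [b [/in_left_right[-> ->] /in_left_right[-> ->]]].
  by rewrite adj_irrefl.
by apply/existsP; exists (inl x); apply/existsP; exists (inl y); rewrite !eqxx.
Qed.

Lemma adj_in_right x y : adj (in_right x) (in_right y) = adj x y.
Proof.
apply/idP/idP => [/glue_adjP[|[a [b [/in_right_inj-> /in_right_inj->]]]] //|xy].
  case=> a [b [/esym/in_left_right[-> ->] /esym/in_left_right[-> ->]]].
  by rewrite adj_irrefl.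
by apply/existsP; exists (inr x); apply/existsP; exists (inr y); rewrite !eqxx.
Qed.

Lemma adj_right_left y x : adj (in_right y) (in_left x) -> x != u ->
  y = v /\ adj u x.
Proof.
case/glue_adjP=> -[a [b [e1 e2 ab]]] xu.
  have /in_left_right[E1 ->] := esym e1.
  by rewrite (in_left_inj e2) -E1.
by have [E] := in_left_right e2; rewrite E eqxx in xu.
Qed.

End Glue.

(** The glued tree consists of the copy [DQ] of [Q], the vertices [DL] of the path
before [s] and the vertices [DR] after [s]; the only edges between the three
parts join [s] to its two neighbours on the path. *)
Lemma represents_glue n (Q : sgraph) (v : Q) t (s : path_graph n) :
  represents t setT v ->
  represents (attach (attach t s) (n.-1 - s)) [set: glue s v] (in_left s v s).
Proof.
move=> rt; have sn := ltn_ord s.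
pose DQ := in_right s v @: setT.
pose DL := in_left s v @: [set x : path_graph n | x < s].
pose DR := in_left s v @: [set x : path_graph n | s < x].
have rQ : represents t DQ (in_left s v s).
  rewrite -in_right_root; apply: represents_embed rt.
    exact: in_right_inj.
  exact: adj_in_right.
have QI (D : {set path_graph n}) : s \notin D -> [disjoint DQ & in_left s v @: D].
  move=> sD; rewrite -setI_eq0; apply/eqP/setP => z; rewrite !inE.
  apply/negP => /andP[/imsetP[y _ ->] /imsetP[x xD /esym/in_left_right[E _]]].
  by rewrite -E xD in sD.
have iA := @adj_in_left (path_graph n) Q s v.
have iI := @in_left_inj (path_graph n) Q s v.
have rL : represents (attach t s) (DQ :|: DL) (in_left s v s).
  apply: represents_attach rQ _ _; first by rewrite QI // inE ltnn.
  case es : (nat_of_ord s) => [|k].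
    rewrite /DL es; apply/setP => z; rewrite !inE.
    by apply/imsetP => -[x]; rewrite inE.
  have kn : k < n by lia.
  exists (in_left s v (Ordinal kn)); split.
  - have := represents_embed iI iA (@represents_lower n k (Ordinal kn) erefl).
    rewrite /DL; suff -> : [set x : path_graph n | x < s] =
        [set x : path_graph n | x <= Ordinal kn] by [].
    by apply/setP => x; rewrite !inE es.
  - by rewrite iA /= /path_adj /= es eqxx orbT.
  move=> _ _ /imsetP[y _ ->] /imsetP[x + ->]; rewrite inE => xs.
  case/adj_right_left => [|-> /= sx].
    by apply: contraTneq xs => ->; rewrite ltnn.
  rewrite in_right_root; split=> //; congr (in_left s v _); apply: val_inj => /=.
  by move: sx; rewrite /path_adj; lia.
have -> : [set: glue s v] = (DQ :|: DL) :|: DR.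
  apply/setP => z; rewrite !inE; apply/esym.
  case: (glue_vertexP z) => [[x ->]|[y _ ->]]; last by rewrite imset_f ?inE.
  rewrite !mem_imset // !inE; case: (ltngtP x s) => [||e]; rewrite ?orbT //.
  by rewrite (val_inj e) -in_right_root imset_f ?inE.
apply: represents_attach rL _ _.
  rewrite disjoints_subset subUset -!disjoints_subset QI ?inE ?ltnn //=.
  rewrite imset_disjoint; last exact: iI.
  rewrite -setI_eq0; apply/eqP/setP => z; rewrite !inE.
  by apply/negP => /andP[zs /(ltn_trans zs)]; rewrite ltnn.
case ek : (n.-1 - s) => [|k].
  apply/setP => z; rewrite !inE; apply/imsetP => -[x]; rewrite inE.
  by have := ltn_ord x; lia.
have kn : s.+1 < n by lia.
exists (in_left s v (Ordinal kn)); split.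
- have sk : Ordinal kn + k.+1 = n by rewrite /=; lia.
  by have := represents_embed iI iA (represents_upper sk).
- by rewrite iA /= /path_adj /= eqxx.
move=> z _ zD /imsetP[x + ->]; rewrite inE => xs.
have xns : x != s by apply: contraTneq xs => ->; rewrite ltnn.
case/setUP: zD => [/imsetP[y _ ->]|/imsetP[y + ->]].
  case/adj_right_left => // -> /= sx.
  rewrite in_right_root; split=> //; congr (in_left s v _); apply: val_inj => /=.
  by move: sx; rewrite /path_adj; lia.
by rewrite inE iA /= /path_adj; lia.
Qed.

Lemma glue_mean_le n (Q : sgraph) (v : Q) (s s' : path_graph n) :
  2 < n -> is_tree Q -> 1 < #|Q| ->
  (mean_subtree_order (glue s v) <= mean_subtree_order (glue s' v))%R =
  (eccentricity s' <= eccentricity s).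
Proof.
move=> n3 treeQ Q2; have [t rt] := tree_represented v treeQ.
have sn := ltn_ord s; have sn' := ltn_ord s'.
rewrite !(represents_mean (represents_glue _ rt)).
have t2 : 1 < nroot t.
  case: t rt => [|t1 t2] rt /=.
    have D1 : [set: Q] = [set v] by inversion rt.
    by rewrite -cardsT D1 cards1 in Q2.
  by apply: leq_trans (leq_pmull _ (nroot_gt0 t1)); rewrite ltnS nroot_gt0.
rewrite two_arms_mean_le //; [|lia..].
by rewrite product_le_max ?path_graph_ecc //; lia.
Qed.

Theorem lemma3p1 (n : nat) (hn : 3 <= n) (Q : sgraph) (hQ : is_tree Q)
    (hQ2 : 2 <= #|Q|) (v : Q) (c : path_graph n) (hc : c.+1 = n.+1 %/ 2) :
  let T (s : path_graph n) : sgraph := glue s v in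
  optimal T c /\ (forall s : path_graph n, optimal T s <-> central s).
Proof.
have opt s : optimal (fun s : path_graph n => glue s v) s <-> central s.
  by split=> h t; have := h t; rewrite glue_mean_le.
move=> T; split; last exact: opt.
apply: (proj2 (opt c)) => s; rewrite !path_graph_ecc.
by have := ltn_ord s; lia.
Qed.
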